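(* Let $\alpha\in[0,1]$ and $\rho>0$ be fixed. For every $f\in C_2^*[0,\infty)$, $$\lim_{n\to\infty}\|A_n^{\alpha,\rho}(f;\cdot)-f\|_2=0$$ (where $n$ ranges over positive integers with $n\rho>2$).
   Context: For $n\in\mathbb{N}$, $n\ge 1$, $k=0,1,2,\dots$, $\alpha\in[0,1]$, $\rho>0$ and $x\in[0,\infty)$ put $$p_{n,k}^{\alpha}(x)=\frac{x^{k-1}}{(1+x)^{n+k-1}}\left\{\frac{\alpha x}{1+x}\binom{n+k-1}{k}-(1-\alpha)(1+x)\binom{n+k-3}{k-2}+(1-\alpha)x\binom{n+k-1}{k}\right\},$$ where $\binom{n+k-3}{k-2}$ is taken to be $0$ for $k=0,1$ (so for $k=0$ the factor $x^{-1}$ cancels and $p_{n,0}^{\alpha}(x)=(1+x)^{-(n-1)}\left(\frac{\alpha}{1+x}+1-\alpha\right)$, also at $x=0$). For $t\ge 0$ put $$\mu_{n,k}^{\rho}(t)=\frac{t^{k\rho}}{B(k\rho+1,n\rho)(1+t)^{n\rho+k\rho+1}},$$ where $B$ is the Beta function. The operators are $$A_n^{\alpha,\rho}(f;x)=\sum_{k=0}^{\infty}p_{n,k}^{\alpha}(x)\int_0^{\infty}\mu_{n,k}^{\rho}(t)f(t)\,dt .$$ Let $D_2[0,\infty)$ be the set of functions $f$ on $[0,\infty)$ for which there is a constant $A_f>0$, depending only on $f$, with $|f(x)|\le A_f(1+x^2)$ for all $x\ge 0$. Put $C_2[0,\infty)=D_2[0,\infty)\cap C[0,\infty)$ and $C_2^*[0,\infty)=\{f\in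 C_2[0,\infty):\ \lim_{x\to\infty}\frac{|f(x)|}{1+x^2}\text{ exists and is finite}\}$, with norm $\|f\|_2=\sup_{x\in[0,\infty)}\frac{|f(x)|}{1+x^2}$. *)

(* Defs.v *)
From HB Require Import structures.
From mathcomp Require Import all_boot all_order all_algebra.
From mathcomp Require Import all_classical all_reals all_analysis.
Set Implicit Arguments.
Unset Strict Implicit.
Unset Printing Implicit Defensive.
Import Order.TTheory GRing.Theory Num.Theory.
Import numFieldNormedType.Exports.
Local Open Scope classical_set_scope.
Local Open Scope ring_scope.

(* Euler's Beta function at real arguments; [beta_fun] of the library only
   takes natural numbers. *)
Definition Beta (R : realType) (a b : R) : R :=
  \int[lebesgue_measure]_(t in `]0, 1[) (t `^ (a - 1) * (1 - t) `^ (b - 1)).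

(* binom(n+k-3, k-2), equal to 0 for k = 0, 1. The test is needed because
   truncated subtraction would give 'C(n - 2, 0) = 1 at k = 1. For n >= 1 and
   k >= 2 no subtraction truncates. *)
Definition shifted_bin (n k : nat) : nat :=
  if (k < 2)%N then 0%N else 'C(n + k - 3, k - 2).

(* The basis functions p_{n,k}^alpha, for n >= 1. At k = 0 the factor x^-1 of
   the general formula cancels; since 0^-1 = 0 in the library, that case is
   written in its simplified form, valid at x = 0 too (see [bask_basis0E]). *)
Definition bask_basis (R : realType) (alpha : R) (n k : nat) (x : R) : R :=
  if k == 0%N then
    (alpha / (1 + x) + (1 - alpha)) / (1 + x) ^+ (n - 1)
  else
    x ^+ (k - 1) / (1 + x) ^+ (n + k - 1) *
    (alpha * x / (1 + x) * 'C(n + k - 1, k)%:R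
     - (1 - alpha) * (1 + x) * (shifted_bin n k)%:R
     + (1 - alpha) * x * 'C(n + k - 1, k)%:R).

Lemma bask_basis0E (R : realType) (alpha : R) (n : nat) (x : R) : 0 < x ->
  bask_basis alpha n 0 x =
    x^-1 / (1 + x) ^+ (n + 0 - 1) *
    (alpha * x / (1 + x) * 'C(n + 0 - 1, 0)%:R
     - (1 - alpha) * (1 + x) * (shifted_bin n 0)%:R
     + (1 - alpha) * x * 'C(n + 0 - 1, 0)%:R).
Proof.
move=> x0; rewrite /bask_basis /shifted_bin /= addn0 bin0 !mulr1 mulr0 subr0.
rewrite mulrAC [in RHS]mulrDr; congr (_ / _).
have xN0 : x != 0 by rewrite gt_eqF.
by rewrite [alpha * x]mulrC [_ * x]mulrC -!mulrA !mulKf.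
Qed.

Definition mu_kernel (R : realType) (rho : R) (n k : nat) (t : R) : R :=
  t `^ (k%:R * rho) /
  (Beta (k%:R * rho + 1) (n%:R * rho)
   * (1 + t) `^ (n%:R * rho + k%:R * rho + 1)).

(* Both the integral and the sum of the series are total operations; for f in
   [C2] and n * rho > 2 the integrals and the series converge absolutely. *)
Definition bask_op (R : realType) (alpha rho : R) (n : nat) (f : R -> R)
    (x : R) : R :=
  limn (series (fun k : nat => bask_basis alpha n k x *
    \int[lebesgue_measure]_(t in `[0, +oo[) (mu_kernel rho n k t * f t))).

(* A function on [0, +oo[ is represented by a function on R of which only the
   values at nonnegative points matter, here and below. *)
Definition D2 (R : realType) : set (R -> R) :=
  [set f : R -> R | exists2 A : R, 0 < A &
     forall x, 0 <= x -> `|f x| <= A * (1 + x ^+ 2)].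

Definition C2 (R : realType) : set (R -> R) :=
  @D2 R `&` [set f : R -> R | {within `[0, +oo[, continuous f}].

(* The limit is taken in R, hence finite. *)
Definition C2star (R : realType) : set (R -> R) :=
  @C2 R `&` [set f : R -> R |
     exists l : R, `|f x| / (1 + x ^+ 2) @[x --> +oo] --> l].

(* The weighted sup norm, +oo when the weighted function is unbounded. *)
Definition norm2 (R : realType) (g : R -> R) : \bar R :=
  ereal_sup [set (`|g x| / (1 + x ^+ 2))%:E | x in `[0, +oo[].

(* Main.v *)
Require Import Defs.
From HB Require Import structures.
From mathcomp Require Import all_boot all_order all_algebra.
From mathcomp Require Import all_classical all_reals all_analysis.
From mathcomp Require Import measurable_realfun ring lra zify.
Import Order.TTheory GRing.Theory Num.Theory.
Import numFieldNormedType.Exports.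
Local Open Scope classical_set_scope.
Local Open Scope ring_scope.

(* Put b_k(x) = binom(n+k-1,k) x^k/(1+x)^(n+k) (the Baskakov weights) and
   J_k(f) = integral of mu_{n,k} f.  The basis p_{n,k}^alpha takes negative
   values, but
     p_{n,k}^alpha(x) = b_k(x) + (1-alpha) x (b_k(x) - b_{k-2}(x)),
   and x (b_k - b_{k-1}) equals (x - k/m)/(1+x) times the weight b_k of
   parameter m = n-1.  Hence the signed part of the operator is at most
   sum_k |x - k/m|/(1+x) b_k(x) |J_k(f)|, which by AM-GM and the moments of
   the negative binomial law of order at most 4 is O((1+x^2)/sqrt m).
   The remaining operator f |-> sum_k b_k J_k(f) is positive.  Since
   |f|/(1+x^2) converges at infinity, so does f/(1+x^2), f having constant sign
   there when the limit is nonzero; so for every eps > 0 there is C with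
   |f(t) - f(x)| <= eps (1+x^2) + C (t-x)^2, and the operator maps (t-x)^2 to
   O((1+x^2)/n). *)

(** * Sums of the negative binomial weights *)

(* [nbin n k x] is the Baskakov weight of parameter [n + 1], which avoids the
   truncated subtraction in the binomial coefficient. *)
Definition nbin {R : realType} (n k : nat) (x : R) : R :=
  'C(n + k, k)%:R * x ^+ k / (1 + x) ^+ (n + k).+1.

Lemma cvg_series_recl {R : realType} (u : R ^nat) (l : R) :
  series (fun k => u k.+1) @ \oo --> l -> series u @ \oo --> u 0%N + l.
Proof.
move=> ul; rewrite -cvg_shiftS.
rewrite (_ : (fun _ => _) = (fun=> u 0%N) \+ series (fun k => u k.+1)).
  by apply: cvgD => //; exact: cvg_cst.
by apply/funext => n /=; rewrite /series /= big_nat_recl.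
Qed.

Lemma cvg_series_dom {R : realType} (u v : R ^nat) (U : R) :
  (forall k, `|v k| <= u k) -> series u @ \oo --> U ->
  cvgn (series v) /\ `|limn (series v)| <= U.
Proof.
move=> vu uU.
have cnv : cvgn [normed series v].
  apply: (@series_le_cvg _ (fun k => `|v k|) u) => // [k|].
  - exact: le_trans (vu k).
  - by apply/cvg_ex; exists U.
split; first exact: normed_cvg.
apply: (le_trans (lim_series_norm cnv)).
rewrite -(cvg_lim _ uU)//; apply: lim_series_le => //.
by apply/cvg_ex; exists U.
Qed.

Section NegativeBinomial.
Context {R : realType}.
Implicit Types (n k j : nat) (x : R).

Lemma nbin_ge0 n k x : 0 <= x -> 0 <= nbin n k x.
Proof.
by move=> x0; rewrite /nbin divr_ge0 ?mulr_ge0 ?exprn_ge0// addr_ge0.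
Qed.

(** Pascal's rule for the binomial coefficient. Summed over [k], it links the partial sums of
    parameter [n.+1] to those of parameter [n]. *)
Lemma nbinSS n k x : 0 <= x ->
  nbin n.+1 k.+1 x = nbin n k.+1 x / (1 + x) + x / (1 + x) * nbin n.+1 k x.
Proof.
move=> x0; have x1 : 1 + x != 0 by rewrite gt_eqF// ltr_pwDl.
rewrite /nbin.
have -> : (n.+1 + k.+1 = (n + k).+2)%N by lia.
have -> : (n + k.+1 = (n + k).+1)%N by lia.
have -> : (n.+1 + k = (n + k).+1)%N by lia.
rewrite binS natrD !exprS; field.
by rewrite x1 expf_neq0.
Qed.

(** Absorption identity for binomial coefficients: a factor [k.+1] is traded for a raised parameter.
    Each use lowers the order of a factorial moment by one. *)
Lemma nbin_index_shift n k x : 0 <= x ->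
  k.+1%:R * nbin n k.+1 x = n.+1%:R * x * nbin n.+1 k x.
Proof.
move=> x0; have x1 : 1 + x != 0 by rewrite gt_eqF// ltr_pwDl.
have -> : nbin n k.+1 x = 'C(n.+1 + k, k.+1)%:R * x ^+ k.+1 / (1 + x) ^+ (n.+1 + k).+1.
  by rewrite /nbin addSnnS.
rewrite /nbin !mulrA -natrM.
have -> : (k.+1 * 'C(n.+1 + k, k.+1) = n.+1 * 'C(n.+1 + k, k))%N.
  by rewrite mul_bin_left addnK.
by rewrite natrM exprS; congr (_ / _); ring.
Qed.

(** Induction on [n], from a geometric series at [n = 0]. In the step the partial sums increase and
    stay below 1, and their limit [l] solves [l = (1 + x * l) / (1 + x)], so [l = 1]. *)
Lemma nbin_sum n x : 0 <= x -> series (fun k => nbin n k x) @ \oo --> (1 : R).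
Proof.
move=> x0; have x1 : 0 < 1 + x by rewrite ltr_pwDl.
elim: n => [|n IH].
  have -> : (fun k => nbin 0 k x) = geometric (1 + x)^-1 (x / (1 + x)).
    apply/funext => k.
    by rewrite /nbin /geometric/= add0n binn mul1r expr_div_n exprSr invfM; ring.
  rewrite [X in _ --> X](_ : _ = (1 + x)^-1 / (1 - x / (1 + x))); last first.
    by field; rewrite addrK oner_neq0 gt_eqF.
  apply: cvg_geometric_series.
  by rewrite ger0_norm ?divr_ge0 ?(ltW x1)// ltr_pdivrMr// mul1r ltrDr.
set s := series (fun k => nbin n.+1 k x).
set a := series (fun k => nbin n k x) in IH.
have sr K : s K.+1 = s K + nbin n.+1 K x by rewrite /s/= /series/= big_nat_recr.
have ar K : a K.+1 = a K + nbin n K x by rewrite /a/= /series/= big_nat_recr.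
have sS K : s K.+1 = (1 + x)^-1 * a K.+1 + x / (1 + x) * s K.
  elim: K => [|K IHK].
    rewrite /s /a /series/= !big_nat1 big_nil mulr0 addr0 /nbin !addn0 !bin0.
    by rewrite !expr0 !mul1r [(_ ^+ n.+2)]exprSr invfM mulrC.
  by rewrite (sr K.+1) [in LHS]IHK nbinSS// (ar K.+1) (sr K); ring.
have s_nd : nondecreasing_seq s.
  apply/nondecreasing_seqP => K; rewrite sr lerDl.
  exact: nbin_ge0.
have a1 K : a K <= 1.
  rewrite -(cvg_lim _ IH)//.
  apply: nondecreasing_cvgn_le; last by apply/cvg_ex; exists 1.
  apply/nondecreasing_seqP => i; rewrite ar lerDl.
  exact: nbin_ge0.
(* By [sS], each partial sum is at most a convex combination of two numbers bounded by 1, since the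
   weights [1 / (1 + x)] and [x / (1 + x)] add up to 1. *)
have s1 K : s K <= 1.
  elim: K => [|K IHK]; first by rewrite /s /series/= big_nil.
  rewrite sS.
  apply: (@le_trans _ _ ((1 + x)^-1 * 1 + x / (1 + x) * 1)).
    by rewrite lerD// ler_wpM2l// ?divr_ge0 ?invr_ge0 ?(ltW x1).
  by rewrite le_eqVlt; apply/orP; left; apply/eqP; field; rewrite gt_eqF.
have /cvg_ex[/= l sl] : cvgn s.
  apply: nondecreasing_is_cvgn => //.
  by exists 1 => _ [K _ <-].
suff <- : l = 1 by [].
have h : (fun K => s K.+1) @ \oo --> (1 + x)^-1 * 1 + x / (1 + x) * l.
  rewrite (_ : (fun K => s K.+1) =
    (fun K => (1 + x)^-1 * a K.+1 + x / (1 + x) * s K)); last exact/funext.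
  by apply: cvgD; apply: cvgMr => //; rewrite (cvg_shiftS a).
have {h} : l = (1 + x)^-1 * 1 + x / (1 + x) * l.
  by rewrite -{1}(cvg_lim _ sl)//; apply: cvg_lim => //; rewrite -(cvg_shiftS s).
move=> /(congr1 (fun y => y * (1 + x))).
have -> : ((1 + x)^-1 * 1 + x / (1 + x) * l) * (1 + x) = 1 + x * l.
  by field; rewrite gt_eqF.
by move=> h; lra.
Qed.

(** Factorial moments of the negative binomial law. The term of index 0 vanishes for positive order,
    and [nbin_index_shift] turns the remaining series into the moment of order [j] for [n.+1]; hence
    the induction on [j] keeps [n] general. *)
Lemma nbin_sum_ffact j n x : 0 <= x ->
  series (fun k => nbin n k x * (k ^_ j)%:R) @ \oo -->
  (\prod_(i < j) (n + i.+1)%:R) * x ^+ j.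
Proof.
move=> x0; elim: j n => [|j IH] n.
  rewrite big_ord0 mul1r; under eq_fun do rewrite ffactn0 mulr1.
  exact: nbin_sum.
set l := (X in _ --> X).
rewrite (_ : l = nbin n 0 x * (0 ^_ j.+1)%:R + l); last first.
  by rewrite ffact0n mulr0 add0r.
apply: (@cvg_series_recl _ (fun k => nbin n k x * (k ^_ j.+1)%:R)).
rewrite /l.
rewrite (_ : (fun k => _) = (n.+1%:R * x) *: (fun k => nbin n.+1 k x * (k ^_ j)%:R)); last first.
  apply/funext => k; rewrite ffactSS natrM mulrCA mulrA nbin_index_shift//.
  by rewrite -[RHS]/(n.+1%:R * x * (nbin n.+1 k x * (k ^_ j)%:R)) !mulrA.
rewrite seriesZ big_ord_recl/= addn1 exprS.
have -> : \prod_(i < j) (n + (lift ord0 i).+1)%:R = \prod_(i < j) (n.+1 + i.+1)%:R :> R.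
  by apply: eq_bigr => i _; rewrite lift0 addSnnS.
rewrite mulrACA; exact: cvgMr (IH n.+1).
Qed.

End NegativeBinomial.

(** * Power moments up to order four and the mean absolute deviation *)

Section Moments.
Context {R : realType}.
Implicit Types (n k j : nat) (x : R).

Lemma natr_ffactS k j : (k ^_ j.+1)%:R = (k ^_ j)%:R * (k%:R - j%:R) :> R.
Proof.
rewrite ffactnSr natrM; have [jk|kj] := leqP j k; first by rewrite natrB.
by rewrite ffact_small// !mul0r.
Qed.

(** Powers of [k] are expanded in falling factorials; the coefficients 1, 1 for the square, 1, 3, 1
    for the cube and 1, 7, 6, 1 for the fourth power are Stirling numbers of the second kind. *)
Lemma nbin_moments n x (c0 c1 c2 c3 c4 : R) (m := n.+1%:R) : 0 <= x ->
  series (fun k => nbin n k x * (c0 + c1 * k%:R + c2 * k%:R ^+ 2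
    + c3 * k%:R ^+ 3 + c4 * k%:R ^+ 4)) @ \oo -->
  c0 + c1 * (m * x) + c2 * (m * (m + 1) * x ^+ 2 + m * x)
  + c3 * (m * (m + 1) * (m + 2) * x ^+ 3 + 3 * (m * (m + 1) * x ^+ 2) + m * x)
  + c4 * (m * (m + 1) * (m + 2) * (m + 3) * x ^+ 4
          + 6 * (m * (m + 1) * (m + 2) * x ^+ 3)
          + 7 * (m * (m + 1) * x ^+ 2) + m * x).
Proof.
move=> x0.
pose g j := (fun k => nbin n k x * (k ^_ j)%:R) : R ^nat.
have gE (d0 d1 d2 d3 d4 : R) : series (d0 *: g 0%N + d1 *: g 1%N + d2 *: g 2%N
    + d3 *: g 3%N + d4 *: g 4%N) @ \oo -->
    d0 * 1 + d1 * (m * x) + d2 * (m * (m + 1) * x ^+ 2)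
    + d3 * (m * (m + 1) * (m + 2) * x ^+ 3)
    + d4 * (m * (m + 1) * (m + 2) * (m + 3) * x ^+ 4).
  have gj j := nbin_sum_ffact j n x x0.
  have mE i : (n + i.+1)%:R = m + i%:R by rewrite addnS -addSn natrD.
  rewrite !seriesD !seriesZ.
  apply: cvgD; [apply: cvgD; [apply: cvgD; [apply: cvgD|]|]|]; apply: cvgMr.
  - by have := gj 0%N; rewrite big_ord0 mul1r.
  - by have := gj 1%N; rewrite !big_ord_recr big_ord0/= !mE mul1r addr0 expr1.
  - by have := gj 2%N; rewrite !big_ord_recr big_ord0/= !mE mul1r addr0.
  - by have := gj 3%N; rewrite !big_ord_recr big_ord0/= !mE mul1r addr0.
  - by have := gj 4%N; rewrite !big_ord_recr big_ord0/= !mE mul1r addr0.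
rewrite (_ : (fun k => _) = c0 *: g 0%N + (c1 + c2 + c3 + c4) *: g 1%N
    + (c2 + 3 * c3 + 7 * c4) *: g 2%N + (c3 + 6 * c4) *: g 3%N + c4 *: g 4%N); last first.
  apply/funext => k.
  transitivity (c0 * g 0%N k + (c1 + c2 + c3 + c4) * g 1%N k
    + (c2 + 3 * c3 + 7 * c4) * g 2%N k + (c3 + 6 * c4) * g 3%N k + c4 * g 4%N k) => //.
  by rewrite /g !natr_ffactS ffactn0; ring.
rewrite [X in _ --> X](_ : _ = c0 * 1 + (c1 + c2 + c3 + c4) * (m * x)
  + (c2 + 3 * c3 + 7 * c4) * (m * (m + 1) * x ^+ 2)
  + (c3 + 6 * c4) * (m * (m + 1) * (m + 2) * x ^+ 3)
  + c4 * (m * (m + 1) * (m + 2) * (m + 3) * x ^+ 4)); last by ring.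
exact: gE.
Qed.

(** By AM-GM, [|d| / (1 + x) <= eta / 2 + d ^ 2 / (2 eta (1 + x) ^ 2)]. The resulting majorant is a
    quartic polynomial in [k] times the weight, so [nbin_moments] sums it exactly. The majorant
    itself is exposed because it later dominates the signed series termwise. *)
Lemma nbin_absolute_deviation n x (eta : R) (m := n.+1%:R) :
  0 <= x -> 0 < eta ->
  exists2 u : R ^nat,
    (forall k, nbin n k x *
      (`|x - k%:R / m| / (1 + x) * (1 + (k%:R / m) ^+ 2)) <= u k) &
    exists2 U : R, series u @ \oo --> U &
      U <= (1 + x ^+ 2) * (2 * eta + 11 / (m * eta)).
Proof.
move=> x0 eta0; have x1 : 0 < 1 + x by rewrite ltr_pwDl.
have m0 : 0 < m by rewrite ltr0n.
have m1 : m^-1 <= 1 by rewrite invf_le1// ler1n.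
pose c := (2 * eta * (1 + x) ^+ 2)^-1.
have c0 : 0 < c by rewrite invr_gt0 !mulr_gt0// exprn_gt0.
exists (fun k => nbin n k x * ((eta / 2 + c * (x - k%:R / m) ^+ 2)
                                 * (1 + (k%:R / m) ^+ 2))).
  move=> k; rewrite ler_wpM2l ?nbin_ge0//.
  rewrite ler_wpM2r ?addr_ge0 ?sqr_ge0//.
  set d := x - _.
  rewrite -(real_normK (num_real d)); set a := `|d|.
  rewrite -subr_ge0 (_ : _ - _ = (a / (1 + x) - eta) ^+ 2 / (2 * eta)).
    by rewrite divr_ge0 ?sqr_ge0// mulr_ge0// ltW.
  by rewrite /c; field; rewrite !gt_eqF.
(* The factor of [eta / 2] is the mean of [1 + (k / m) ^ 2], and the factor of [c] is the mean of
   [(x - k / m) ^ 2 * (1 + (k / m) ^ 2)]. *)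
exists (eta / 2 * (1 + x ^+ 2 + m^-1 * (x * (1 + x))) + c * (m^-1 * (x * (1 + x)) *
  (1 + x ^+ 2 + 2 * x * (1 + 2 * x) * m^-1 + 3 * (x * (1 + x)) * m^-1
     + (1 + 6 * x + 6 * x ^+ 2) * m^-1 ^+ 2))).
  have := nbin_moments n x (eta / 2 + c * x ^+ 2) (- 2 * c * x / m)
    (eta / 2 / m ^+ 2 + c / m ^+ 2 + c * x ^+ 2 / m ^+ 2) (- 2 * c * x / m ^+ 3)
    (c / m ^+ 4) x0.
  rewrite -/m; set l := (X in _ --> X -> _) => H.
  rewrite [X in _ --> X](_ : _ = l); last by rewrite /l; field; rewrite gt_eqF.
  rewrite (_ : (fun k => _) = (fun k => nbin n k x * (eta / 2 + c * x ^+ 2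
    + (- 2 * c * x / m) * k%:R
    + (eta / 2 / m ^+ 2 + c / m ^+ 2 + c * x ^+ 2 / m ^+ 2) * k%:R ^+ 2
    + (- 2 * c * x / m ^+ 3) * k%:R ^+ 3 + (c / m ^+ 4) * k%:R ^+ 4)))//.
  by apply/funext => k; congr *%R; field; rewrite gt_eqF.
set p := m^-1 in m1 *; have p0 : 0 < p by rewrite invr_gt0.
have px y : 0 <= y -> y * p <= y by move=> y0; rewrite ler_piMr.
(* With [p <= 1] the left side is at most [2 + 11 x + 14 x ^ 2], which 22 absorbs. Half of 22 is the
   constant 11 of the statement. *)
have B : 1 + x ^+ 2 + 2 * x * (1 + 2 * x) * p + 3 * (x * (1 + x)) * p
     + (1 + 6 * x + 6 * x ^+ 2) * p ^+ 2 <= 22 * (1 + x ^+ 2).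
  have h1 : 2 * x * (1 + 2 * x) * p <= 2 * x * (1 + 2 * x).
    by apply: px; rewrite !mulr_ge0// addr_ge0// mulr_ge0.
  have h2 : 3 * (x * (1 + x)) * p <= 3 * (x * (1 + x)).
    by apply: px; rewrite !mulr_ge0// addr_ge0.
  have h3 : (1 + 6 * x + 6 * x ^+ 2) * p ^+ 2 <= 1 + 6 * x + 6 * x ^+ 2.
    rewrite ler_piMr ?expr_le1// ?(ltW p0)//.
    by rewrite !addr_ge0// ?mulr_ge0// exprn_ge0.
  nra.
apply: (@le_trans _ _ (eta / 2 * (4 * (1 + x ^+ 2)) +
    (2 * eta)^-1 * (p * (22 * (1 + x ^+ 2))))); last first.
  rewrite le_eqVlt; apply/orP; left; apply/eqP; rewrite /p; field.
  by rewrite !gt_eqF.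
apply: lerD.
  rewrite ler_pM2l ?divr_gt0//.
  have : p * (x * (1 + x)) <= x * (1 + x) by rewrite mulrC px// mulr_ge0// ltW.
  by nra.
have -> : c = (2 * eta)^-1 / (1 + x) ^+ 2 by rewrite /c invfM.
rewrite -mulrA ler_pM2l ?invr_gt0 ?mulr_gt0//.
set S := (1 + x ^+ 2 + _ + _ + _) in B *.
have S0 : 0 <= S.
  by rewrite !addr_ge0// ?sqr_ge0// !mulr_ge0// ?addr_ge0 ?mulr_ge0// ?ltW// exprn_ge0.
rewrite mulrC ler_pdivrMr ?exprn_gt0// -!mulrA ler_pM2l//.
rewrite mulrA [leRHS]mulrA [leRHS]mulrC.
by apply: ler_pM => //; [rewrite mulr_ge0// ltW|nra].
Qed.

End Moments.

(** * The signed part of the basis *)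

Section BasisPerturbation.
Context {R : realType}.
Implicit Types (n k : nat) (x alpha : R).

(** The case [k = 0] stands apart: of the two deviation terms found at positive indices only the one
    of index [k] is present. *)
Lemma bask_basis_nbin0 alpha n x : 0 <= x ->
  bask_basis alpha n.+2 0 x =
  nbin n.+1 0 x + (1 - alpha) * (x / (1 + x) * nbin n 0 x).
Proof.
move=> x0; have x1 : 1 + x != 0 by rewrite gt_eqF// ltr_pwDl.
rewrite /bask_basis /nbin/= subn1/= !addn0 !bin0 !exprS; field.
by rewrite x1 expf_neq0.
Qed.

(* [nbin n.+1 k.+1 - nbin n.+1 k] is [nbin n k.+1] times an explicit linear
   function of [k]; the [1 - alpha] part of the basis is, up to the factor
   [x], a sum of two such consecutive differences. *)
Lemma bask_basis_nbinS alpha n k x (m := n.+1%:R) : 0 <= x ->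
  bask_basis alpha n.+2 k.+1 x =
  nbin n.+1 k.+1 x +
  (1 - alpha) * ((x - k.+1%:R / m) / (1 + x) * nbin n k.+1 x
                 + (x - k%:R / m) / (1 + x) * nbin n k x).
Proof.
move=> x0; have x1 : 1 + x != 0 by rewrite gt_eqF// ltr_pwDl.
have m0 : m != 0 by rewrite pnatr_eq0.
rewrite /bask_basis /nbin /shifted_bin/=.
(* Index 1 is treated alone because [shifted_bin] is 0 there by convention; from index 2 on it is a
   true binomial coefficient. *)
case: k => [|k]/=.
  have -> : (n.+2 + 1 - 1 = n.+2)%N by lia.
  have -> : (n.+1 + 1 = n.+2)%N by lia.
  have -> : (n + 1 = n.+1)%N by lia.
  rewrite !bin1 addn0 bin0 -[n.+2%:R]natr1 -/m !exprS; field.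
  by rewrite x1 expf_neq0//= addrC natr1.
have -> : (n.+2 + k.+2 - 1 = (n + k).+3)%N by lia.
have -> : (n.+2 + k.+2 - 3 = (n + k).+1)%N by lia.
have -> : (n.+1 + k.+2 = (n + k).+3)%N by lia.
have -> : (n + k.+2 = (n + k).+2)%N by lia.
have -> : (n + k.+1 = (n + k).+1)%N by lia.
have -> : (k.+2 - 2 = k)%N by lia.
have -> : (k.+2 - 1 = k.+1)%N by lia.
have [N NE] : exists N, N = (n + k).+1 by exists (n + k).+1.
rewrite -!NE.
rewrite !binS !natrD.
have k1 : k%:R + 1 != 0 :> R by rewrite natr1 pnatr_eq0.
have k2 : k%:R + 2 != 0 :> R by rewrite -natrD addn2 pnatr_eq0.
(* After Pascal's rule, absorption expresses every coefficient through ['C(N, k)], which leaves a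
   rational identity. *)
have -> : 'C(N, k.+2)%:R = (m - 1) * 'C(N, k.+1)%:R / (k%:R + 2) :> R.
  apply: (mulIf k2); rewrite divfK// /m -(natr1 n) addrK -natrD addn2 -!natrM mulnC.
  by congr (_%:R); rewrite mul_bin_left; congr muln; lia.
have -> : 'C(N, k.+1)%:R = m * 'C(N, k)%:R / (k%:R + 1) :> R.
  apply: (mulIf k1); rewrite divfK// natr1 -!natrM mulnC.
  by congr (_%:R); rewrite mul_bin_left; congr muln; lia.
rewrite -(natr1 k.+1) -(natr1 k) !exprS; field.
by rewrite expf_neq0// x1 k1 k2 addrC natr1 m0.
Qed.

(** The weights of parameter [n.+1] average the errors [V k] to [S]. The signed part meets [J k]
    against the deviations of indices [k] and [k - 1]; these cost [K] and [3 * K] times the bound of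
    [nbin_absolute_deviation], hence the factor 4. *)
Lemma bask_sum_error alpha n x eta (J V : R ^nat) (K y S : R)
    (m := n.+1%:R) :
  0 <= alpha <= 1 -> 0 <= x -> 0 < eta ->
  (forall k, `|J k| <= K * (1 + (k%:R / m) ^+ 2)) ->
  (forall k, `|J k - y| <= V k) ->
  series (fun k => nbin n.+1 k x * V k) @ \oo --> S ->
  `|limn (series (fun k => bask_basis alpha n.+2 k x * J k)) - y|
  <= S + 4 * K * ((1 + x ^+ 2) * (2 * eta + 11 / (m * eta))).
Proof.
move=> /andP[alpha0 alpha1] x0 eta0 JK JV VS.
have x1 : 0 < 1 + x by rewrite ltr_pwDl.
have m0 : 0 < m by rewrite ltr0n.
have m1 : m^-1 <= 1 by rewrite invf_le1// ler1n.
have [u udom [U uU Ule]] := nbin_absolute_deviation n x eta x0 eta0.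
have K0 : 0 <= K.
  have := le_trans (normr_ge0 _) (JK 0%N).
  by rewrite mul0r expr0n/= addr0 mulr1.
(* The shifted copy of [u] dominates the deviation term of index [k - 1]; it starts with 0 since
   that term is missing at [k = 0]. *)
pose u' k := if k is k'.+1 then u k' else 0.
have u'U : series u' @ \oo --> U.
  by rewrite -[U]add0r; exact: (@cvg_series_recl _ u').
pose w k := nbin n.+1 k x * V k + (K * u k + 3 * K * u' k).
have wS : series w @ \oo --> S + (K * U + 3 * K * U).
  rewrite (_ : w = (fun k => nbin n.+1 k x * V k) + (K *: u + (3 * K) *: u')) //.
  by rewrite !seriesD !seriesZ; apply: cvgD => //; apply: cvgD; apply: cvgMr.
have dev0 k : 0 <= `|x - k%:R / m| / (1 + x) by rewrite divr_ge0// ltW.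
have A z : `|(1 - alpha) * z| <= `|z|.
  by rewrite normrM ger0_norm ?subr_ge0// ler_piMl// gerBl.
(* With [z = k / m] and [m^-1 <= 1], [1 + (z + m^-1) ^ 2 <= 3 + 2 z ^ 2]; this is the price of
   moving the growth bound back by one index. *)
have JS k : `|J k.+1| <= 3 * K * (1 + (k%:R / m) ^+ 2).
  apply: le_trans (JK k.+1) _.
  rewrite -natr1 mulrDl mul1r [3 * K]mulrC -mulrA ler_wpM2l//.
  set z := k%:R / m; have z0 : 0 <= z by rewrite divr_ge0// ltW.
  have p0 : 0 <= m^-1 by rewrite invr_ge0 ltW.
  have : m^-1 ^+ 2 <= 1 by rewrite expr_le1.
  have := sqr_ge0 (z - m^-1); have := sqr_ge0 z; set p := m^-1; lra.
have devJ k C z : `|z| <= C * (1 + (k%:R / m) ^+ 2) -> 0 <= C ->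
    `|(x - k%:R / m) / (1 + x) * nbin n k x * z| <= C * u k.
  move=> zC C0; apply: le_trans (ler_wpM2l C0 (udom k)).
  rewrite 2!normrM (normrM (x - _)) normfV (gtr0_norm x1) (ger0_norm (nbin_ge0 _ _ _ x0)).
  have := ler_wpM2l (mulr_ge0 (nbin_ge0 n k x x0) (dev0 k)) zC.
  rewrite -/m [_ / _ * nbin _ _ _]mulrC => /le_trans; apply.
  by rewrite le_eqVlt; apply/orP; left; apply/eqP; ring.
have dom k : `|bask_basis alpha n.+2 k x * J k - nbin n.+1 k x * y| <= w k.
  have main : `|nbin n.+1 k x * (J k - y)| <= nbin n.+1 k x * V k.
    by rewrite normrM (ger0_norm (nbin_ge0 _ _ _ x0)) ler_wpM2l ?nbin_ge0.
  case: k main => [|k] main.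
    rewrite bask_basis_nbin0// mulrDl addrAC -mulrBr.
    apply: (le_trans (ler_normD _ _)); apply: lerD => //.
    rewrite /u' mulr0 addr0 -(mulrA (1 - alpha)); apply: (le_trans (A _)).
    by have := devJ 0%N K (J 0%N) (JK 0%N) K0; rewrite mul0r subr0.
  rewrite bask_basis_nbinS// mulrDl addrAC -mulrBr.
  apply: (le_trans (ler_normD _ _)); apply: lerD => //.
  rewrite -(mulrA (1 - alpha)); apply: (le_trans (A _)); rewrite mulrDl.
  apply: (le_trans (ler_normD _ _)); apply: lerD; first exact: devJ.
  by apply: devJ => //; rewrite mulr_ge0.
have [cv lv] := cvg_series_dom w _ _ dom wS.
(* The weights sum to 1, so [y] can be subtracted under the series, term by term. *)
have yU : series (fun k => nbin n.+1 k x * y) @ \oo --> y.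
  rewrite (_ : (fun k => _) = y *: (fun k => nbin n.+1 k x)); last first.
    by apply/funext => k; rewrite mulrC.
  by rewrite seriesZ -[X in _ --> X]mulr1; apply: cvgMr; exact: nbin_sum.
have -> : limn (series (fun k => bask_basis alpha n.+2 k x * J k)) =
  limn (series (fun k => bask_basis alpha n.+2 k x * J k - nbin n.+1 k x * y)) + y.
  rewrite -[X in _ = _ + X](cvg_lim _ yU)// -lim_seriesD//; last first.
    by apply/cvg_ex; exists y.
  congr (limn (series _)); apply/funext => k.
  by rewrite -[RHS]/(_ - _ + _) subrK.
rewrite addrK; apply: le_trans lv _; rewrite lerD2l.
have -> : K * U + 3 * K * U = 4 * K * U by ring.
by rewrite ler_wpM2l// mulr_ge0.
Qed.

End BasisPerturbation.

(** * Beta integrals *)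

Section BetaIntegrals.
Context {R : realType}.
Local Notation mu := (@lebesgue_measure R).
Implicit Types (a b c t u : R).

(* The absolute values make the integrand continuous on the whole line. *)
Definition beta_integrand a b u : R := `|u| `^ (a - 1) * `|1 - u| `^ (b - 1).

(** Away from 0 this is differentiability of the power. At 0 a positive exponent gives the value 0,
    with radius [e] to the power [1 / c], while exponent 0 gives the constant 1. *)
Lemma powR_norm_continuous c : 0 <= c -> continuous (fun t => `|t| `^ c).
Proof.
rewrite le_eqVlt => /predU1P[<-|c0].
  rewrite (_ : (fun t => _) = cst 1); first exact: cst_continuous.
  by apply/funext => t; rewrite powRr0.
move=> t; have [->|t0] := eqVneq t 0.
  apply/cvgrPdist_lt => e e0; rewrite normr0 powR0 ?gt_eqF//.
  near=> u; rewrite sub0r normrN ger0_norm ?powR_ge0//.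
  have -> : e = (e `^ c^-1) `^ c by rewrite -powRrM mulVf ?gt_eqF// powRr1 ?ltW.
  apply: gt0_ltr_powR => //; rewrite ?nnegrE ?powR_ge0//.
  by near: u; exact: (@nbhs0_lt _ R _ (powR_gt0 _ e0)).
apply: (@continuous_comp _ _ _ (fun t => `|t|) (@powR R ^~ c)).
  exact: norm_continuous.
apply: differentiable_continuous; apply/derivable1_diffP.
by apply: derivable_powR; rewrite in_itv/= andbT normr_gt0.
Unshelve. all: by end_near. Qed.


Lemma beta_integrand_continuous a b : 1 <= a -> 1 <= b ->
  continuous (beta_integrand a b).
Proof.
move=> a1 b1 u; apply: (@continuousM _ _ (fun u => `|u| `^ (a - 1))
  (fun u => `|1 - u| `^ (b - 1))); first by apply: powR_norm_continuous; rewrite subr_ge0.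
apply: (@continuous_comp _ _ _ (fun u => 1 - u) (fun t => `|t| `^ (b - 1))).
  by apply: continuousB; [exact: cst_continuous|exact: cvg_id].
by apply: powR_norm_continuous; rewrite subr_ge0.
Qed.

Lemma beta_integrand_integrable a b : 1 <= a -> 1 <= b ->
  mu.-integrable `[0, 1] (EFin \o beta_integrand a b).
Proof.
move=> a1 b1; apply: continuous_compact_integrable; first exact: segment_compact.
by apply: continuous_subspaceT; exact: beta_integrand_continuous.
Qed.

(** The endpoints are null sets. On the closed interval the integrand is continuous for these
    exponents, so compactness and the fundamental theorem of calculus apply. *)
Lemma BetaE a b : 1 <= a -> 1 <= b ->
  Beta a b = \int[mu]_(u in `[0, 1]) beta_integrand a b u.
Proof.
move=> a1 b1; have gi := beta_integrand_integrable a b a1 b1.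
rewrite -Rintegral_itv_obnd_cbnd; last first.
  by apply: integrableS gi => //; apply: subset_itv_oc_cc.
rewrite -Rintegral_itv_bndo_bndc; last first.
  by apply: integrableS gi => //; apply: subset_itv_oo_cc.
apply: eq_Rintegral => u; rewrite inE/= in_itv/= => /andP[u0 u1].
by rewrite /beta_integrand !ger0_norm// ?subr_ge0 ltW.
Qed.

Lemma Beta_gt0 a b : 1 <= a -> 1 <= b -> 0 < Beta a b.
Proof.
move=> a1 b1; rewrite BetaE//.
have gi := beta_integrand_integrable a b a1 b1.
(* A lower bound of the integrand on [[1/4, 1/2]], where [u >= 1/4] and [1 - u >= 1/2]. *)
pose c : R := 4^-1 `^ (a - 1) * 2^-1 `^ (b - 1).
have c0 : 0 < c by rewrite mulr_gt0// powR_gt0.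
have sub : `[4^-1, 2^-1]%classic `<=` `[(0:R), 1]%classic.
  by move=> u/=; rewrite !in_itv/= => /andP[u1 u2]; apply/andP; split; lra.
have g0 u : 0 <= beta_integrand a b u by rewrite mulr_ge0 ?powR_ge0.
have gi' : mu.-integrable `[4^-1, 2^-1] (EFin \o beta_integrand a b).
  exact: integrableS gi.
apply: (@lt_le_trans _ _ (\int[mu]_(u in `[4^-1, 2^-1]) c)).
  rewrite Rintegral_cst//= mulr_gt0// lebesgue_measure_itv/= lte_fin ifT; last by lra.
  by rewrite -EFinB/=; lra.
apply: (@le_trans _ _ (\int[mu]_(u in `[4^-1, 2^-1]) beta_integrand a b u)).
  apply: le_Rintegral => //.
    apply: continuous_compact_integrable; first exact: segment_compact.
    by apply: continuous_subspaceT; exact: cst_continuous.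
  move=> u /=; rewrite in_itv/= => /andP[u1 u2].
  rewrite /beta_integrand !ger0_norm; try lra.
  by apply: ler_pM; rewrite ?powR_ge0//; apply: ge0_ler_powR; rewrite ?nnegrE; lra.
rewrite /Rintegral fine_le ?integrable_fin_num//.
apply: ge0_subset_integral => //; last by move=> u _; rewrite lee_fin.
by case/integrableP : gi.
Qed.

Lemma is_derive_powR_norm c t : 0 < t ->
  is_derive t 1 (fun t => `|t| `^ c) (c * `|t| `^ (c - 1)).
Proof.
move=> t0; rewrite gtr0_norm//.
apply: (@near_eq_is_derive _ _ _ (@powR R ^~ c)); last exact: is_derive1_powR.
by near=> u; rewrite gtr0_norm//; near: u; exact: lt_nbhsr.
Unshelve. all: by end_near. Qed.

(** Integration by parts: the derivative of [u ^ a * (1 - u) ^ (b - 1)] is integrated over [[0, 1]],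
    and this function vanishes at both endpoints. It yields the ratios of Beta values needed for the
    kernel moments. *)
Lemma Beta_rec a b : 1 <= a -> 2 <= b ->
  (b - 1) * Beta (a + 1) (b - 1) = a * Beta a b.
Proof.
move=> a1 b2.
have a0 : a + 1 - 1 = a by rewrite addrK.
have a2 : 1 <= a + 1 by rewrite lerDr (le_trans ler01).
have b1 : 1 <= b by lra.
have b3 : 1 <= b - 1 by lra.
rewrite (BetaE a b a1 b1) (BetaE (a + 1) (b - 1) a2 b3).
have gi1 : mu.-integrable `[0, 1] (EFin \o beta_integrand a b).
  by apply: beta_integrand_integrable; lra.
have gi2 : mu.-integrable `[0, 1] (EFin \o beta_integrand (a + 1) (b - 1)).
  by apply: beta_integrand_integrable; lra.
pose F u : R := beta_integrand (a + 1) b u.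
have cF : continuous F by apply: beta_integrand_continuous; lra.
pose f u : R := a * beta_integrand a b u - (b - 1) * beta_integrand (a + 1) (b - 1) u.
have dF u : 0 < u < 1 -> is_derive u 1 F (f u).
  move=> /andP[u0 u1].
  have d1 := is_derive_powR_norm a u u0.
  have d2 : is_derive u 1 ((fun t => `|t| `^ (b - 1)) \o (fun u => 1 - u))
      ((b - 1) * `|1 - u| `^ (b - 1 - 1) * (-1)).
    apply: is_derive1_comp.
    + by apply: is_derive_powR_norm; rewrite subr_gt0.
    + by rewrite -[X in is_derive _ _ _ X]add0r; apply: is_deriveB.
  rewrite (_ : F = (fun t => `|t| `^ a) * ((fun t => `|t| `^ (b - 1)) \o (fun u => 1 - u))).
    apply: is_derive_eq; rewrite /f /beta_integrand a0 /GRing.scale/=; ring.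
  by apply/funext => t; rewrite /F /beta_integrand a0.
have : (\int[mu]_(u in `[0%R, 1%R]) (f u)%:E = (F 1)%:E - (F 0)%:E)%E.
  apply: continuous_FTC2 => //.
  - apply: continuous_subspaceT => u; rewrite /f.
    by apply: cvgB; apply: cvgMr; apply: beta_integrand_continuous; lra.
  - split; last 2 first.
    + by apply: cvg_at_right_filter; exact: cF.
    + by apply: cvg_at_left_filter; exact: cF.
    + by move=> u; rewrite in_itv/= => u01; have [] := dF u u01.
  - by move=> u; rewrite in_itv/= => u01; rewrite derive1E; have [] := dF u u01.
have -> : F 1 = 0.
  by rewrite /F /beta_integrand subrr normr0 (@powR0 _ (b - 1)) ?mulr0//; lra.
have -> : F 0 = 0.
  by rewrite /F /beta_integrand normr0 a0 powR0 ?mul0r//; lra.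
rewrite sube0 => /(congr1 fine)/= fE.
apply/eqP; rewrite eq_sym -subr_eq0 -!RintegralZl// -RintegralB//.
- exact/eqP.
- exact: (integrableZl _ _ gi1).
- exact: (integrableZl _ _ gi2).
Qed.

End BetaIntegrals.

(** * The Beta integral on the half-line *)

Section BetaPrime.
Context {R : realType}.
Local Notation mu := (@lebesgue_measure R).
Implicit Types (a b c t u : R).

Lemma is_derive_odds t : 0 < t ->
  is_derive t 1 (fun t => t / (1 + t)) ((1 + t) ^- 2).
Proof.
move=> t0; have t1 : 1 + t != 0 by rewrite gt_eqF// ltr_pwDl// ltW.
apply: (@near_eq_is_derive _ _ _ (fun t => 1 - (1 + t)^-1)).
  near=> u; have u1 : 1 + u != 0.
    by rewrite gt_eqF// addr_gt0//; near: u; exact: lt_nbhsr.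
  by field.
have d : is_derive t 1 (fun t => (1 + t)^-1) (- (1 + t) ^- 2 *: 1).
  apply: is_deriveV => //.
  by rewrite -[X in is_derive _ _ _ X]add0r; apply: is_deriveD.
rewrite (_ : _ ^- 2 = 0 - (- (1 + t) ^- 2 *: 1)); last first.
  by rewrite sub0r /GRing.scale/= mulr1 opprK.
by apply: is_deriveB.
Unshelve. all: by end_near. Qed.

(** The substitution [u = t / (1 + t)], carried out by exhibiting an antiderivative: the primitive
    [H] of the Beta integrand composed with [phi]. It is 0 at 0 and tends to [Beta a b] at infinity.
    As an equality of extended reals between a nonnegative integral and a finite number, it also
    settles integrability. *)
Lemma beta_prime_integral a b : 1 <= a -> 1 <= b ->
  (\int[mu]_(t in `[0%R, +oo[) (t `^ (a - 1) / (1 + t) `^ (a + b))%:E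
   = (Beta a b)%:E)%E.
Proof.
move=> a1 b1; have gi := beta_integrand_integrable a b a1 b1.
pose h t : R := `|t| `^ (a - 1) / (1 + `|t|) `^ (a + b).
have ch : continuous h.
  move=> t; have t1 : 0 < 1 + `|t| by rewrite ltr_pwDl.
  apply: cvgM; first by apply: powR_norm_continuous; rewrite subr_ge0.
  apply: cvgV; first by rewrite gt_eqF// powR_gt0.
  apply: (@continuous_comp _ _ _ (fun t => 1 + `|t|) (@powR R ^~ (a + b))).
    by apply: cvgD; [exact: cvg_cst|exact: norm_continuous].
  apply: differentiable_continuous; apply/derivable1_diffP.
  by apply: derivable_powR; rewrite in_itv/= andbT.
pose H v : R := parameterized_integral mu 0 v (beta_integrand a b).
pose phi t : R := t / (1 + t).
rewrite (_ : (\int[mu]_(t in _) _ = \int[mu]_(t in `[0%R, +oo[) (h t)%:E)%E); last first.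
  apply: eq_integral => t; rewrite inE/= in_itv/= andbT => t0.
  by rewrite /h ger0_norm.
have phi01 t : 0 < t -> 0 < phi t < 1.
  move=> t0; have t1 : 0 < 1 + t by rewrite addr_gt0.
  by rewrite divr_gt0//= ltr_pdivrMr// mul1r ltrDr.
have dF t : 0 < t -> is_derive t 1 (H \o phi) (h t).
  move=> t0; have /andP[p0 p1] := phi01 _ t0.
  have t1 : 0 < 1 + t by rewrite addr_gt0.
  have [dH HE] := @continuous_FTC1_closed _ _ 0 (phi t) 1 p1 gi p0
    (beta_integrand_continuous a b a1 b1 (phi t)).
  have d1 : is_derive (phi t) 1 H (beta_integrand a b (phi t)).
    by apply: DeriveDef; [exact: dH|rewrite -derive1E; exact: HE].
  (* Since [1 - phi t = 1 / (1 + t)], the powers of [1 + t] collect as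
     [(a - 1) + (b - 1) + 2 = a + b]. *)
  rewrite (_ : h t = beta_integrand a b (phi t) * (1 + t) ^- 2).
    exact: (is_derive1_comp d1 (is_derive_odds t t0)).
  rewrite /h /beta_integrand !gtr0_norm//; last by rewrite subr_gt0.
  have -> : 1 - phi t = (1 + t)^-1 by rewrite /phi; field; rewrite gt_eqF.
  have nz : 1 + t != 0 by rewrite gt_eqF.
  rewrite powRM ?invr_ge0 ?(ltW t0) ?(ltW t1)//.
  have V c : (1 + t)^-1 `^ c = (1 + t) `^ (- c).
    by rewrite -powR_inv1 ?(ltW t1)// -powRrM mulN1r.
  rewrite !V -powR_mulrn ?(ltW t1)// -!powRN -!mulrA -!powRD ?nz ?implybT//.
  by congr (_ * _ `^ _); ring.
have F0 : H (phi 0) = 0.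
  by rewrite /H /phi mul0r /parameterized_integral set_itv1 Rintegral_set1.
have {1}-> : Beta a b = (Beta a b) - (H \o phi) 0 by rewrite /= F0 subr0.
rewrite EFinB; apply: ge0_continuous_FTC2y.
- by move=> t _; rewrite /h divr_ge0 ?powR_ge0.
- exact: continuous_subspaceT.
(* At infinity [phi] tends to 1 from the left, where [H] converges to its full integral. *)
- rewrite BetaE//.
  apply: (@cvg_comp _ _ _ phi H _ (at_left (1 : R))); last first.
    exact: parameterized_integral_cvg_at_left.
  move=> A [e /= e0 eA]; near=> t.
  have t0 : 0 < t by near: t; exact: nbhs_pinfty_gt.
  have /andP[p0 p1] := phi01 t t0; apply: eA => //=.
  have -> : 1 - phi t = (1 + t)^-1 by rewrite /phi; field; rewrite gt_eqF// addr_gt0.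
  rewrite ger0_norm ?invr_ge0 ?addr_ge0 ?(ltW t0)//.
  rewrite invf_plt ?posrE ?addr_gt0//.
  apply: (@lt_trans _ _ t); last by rewrite ltrDr.
  near: t; apply: nbhs_pinfty_gt; exact: num_real.
- move=> t t0; exact: (@ex_derive _ _ _ _ _ _ _ (dF t t0)).
- rewrite /= F0; apply: (@cvg_comp _ _ _ phi H _ (nbhs (0 : R))).
    apply: cvg_at_right_filter.
    rewrite [X in _ --> X](_ : _ = phi 0); last by rewrite /phi mul0r.
    apply: cvgM; first exact: cvg_id.
    apply: cvgV; first by rewrite addr0 oner_neq0.
    by apply: cvgD; [exact: cvg_cst|exact: cvg_id].
  exact: (@parameterized_integral_cvg_left _ 0 1).
- by move=> t; rewrite in_itv/= andbT => t0; rewrite derive1E; have [] := dF t t0.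
Unshelve. all: by end_near. Qed.

End BetaPrime.

(** * Moments of the kernel *)

Section MuKernel.
Context {R : realType}.
Local Notation mu := (@lebesgue_measure R).
Variables (rho : R) (n k : nat).
Hypotheses (rho0 : 0 < rho) (nrho : 4 <= n%:R * rho).
Local Notation s := (n%:R * rho).
Local Notation a := (k%:R * rho).
Local Notation w := (mu_kernel rho n k).

Let a0 : 0 <= a. Proof. by rewrite mulr_ge0// ltW. Qed.

Let s1 : 1 <= s. Proof. by move: nrho; lra. Qed.

Let B0 : 0 < Beta (a + 1) s. Proof. by apply: Beta_gt0; rewrite ?lerDr. Qed.

Lemma mu_kernel_ge0 t : 0 <= w t.
Proof.
by rewrite divr_ge0 ?powR_ge0// mulr_ge0 ?powR_ge0// ltW.
Qed.

Lemma measurable_mu_kernel : measurable_fun setT w.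
Proof.
apply: measurable_funM; first exact: measurable_powR.
rewrite (_ : (fun t => _) = (fun t => (Beta (a + 1) s)^-1 * (1 + t) `^ (- (s + a + 1)))).
  apply: measurable_funM => //.
  apply: (@measurableT_comp _ _ _ _ _ _ (@powR R ^~ _)); first exact: measurable_powR.
  exact: measurable_funD.
by apply/funext => t; rewrite invfM powRN.
Qed.

(** Multiplying by [t ^ j] moves [j] from the second Beta parameter to the first; their sum, the
    exponent of [1 + t], stays [s + a + 1]. *)
Lemma mu_kernel_moment j : j%:R + 1 <= s ->
  (\int[mu]_(t in `[0%R, +oo[) (w t * t ^+ j)%:E
   = (Beta (a + 1 + j%:R) (s - j%:R) / Beta (a + 1) s)%:E)%E.
Proof.
move=> js; have J0 : 0 <= j%:R :> R by [].
have aj : 1 <= a + 1 + j%:R by move: a0; lra.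
have sj : 1 <= s - j%:R by move: js; lra.
rewrite mulrC EFinM -beta_prime_integral// -ge0_integralZl//.
- apply: eq_integral => t; rewrite inE/= in_itv/= andbT => t0.
  rewrite -EFinM; congr EFin; rewrite /mu_kernel.
  have -> : t `^ (a + 1 + j%:R - 1) = t `^ a * t ^+ j.
    rewrite addrAC addrK -powR_mulrn//.
    (* Splitting a power of [t] at [t = 0] needs a nonzero total exponent, which can fail only for
       [j = 0], as [a] may be 0. *)
    case: j {js J0 aj sj} => [|j]; first by rewrite addr0 powRr0 mulr1.
    by rewrite powRD// gt_eqF// ltr_wpDl.
  rewrite (_ : a + 1 + j%:R + (s - j%:R) = s + a + 1); last by ring.
  by rewrite invfM; ring.
- apply/measurable_EFinP/measurable_funTS; apply: measurable_funM; first exact: measurable_powR.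
  rewrite (_ : (fun t => _) = (fun t : R => (1 + t) `^ (- (a + 1 + j%:R + (s - j%:R))))).
    apply: (@measurableT_comp _ _ _ _ _ _ (@powR R ^~ _)); first exact: measurable_powR.
    exact: measurable_funD.
  by apply/funext => t; rewrite powRN.
- by move=> t _; rewrite lee_fin divr_ge0 ?powR_ge0.
- by rewrite lee_fin invr_ge0 ltW.
Qed.

Lemma mu_kernel_moment_integrable j : j%:R + 1 <= s ->
  mu.-integrable `[0, +oo[ (fun t => (w t * t ^+ j)%:E).
Proof.
move=> js; apply/integrableP; split.
  apply/measurable_EFinP/measurable_funTS; apply: measurable_funM.
    exact: measurable_mu_kernel.
  exact: measurable_funX.
rewrite [ltLHS](_ : _ = (\int[mu]_(t in `[0%R, +oo[) (w t * t ^+ j)%:E)%E).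
  by rewrite mu_kernel_moment// ltry.
apply: eq_integral => t; rewrite inE/= in_itv/= andbT => t0.
by rewrite ger0_norm// mulr_ge0 ?mu_kernel_ge0// exprn_ge0.
Qed.

Let M1 : R := (a + 1) / (s - 1).
Let M2 : R := (a + 1) * (a + 2) / ((s - 1) * (s - 2)).

Lemma mu_kernel_mass : \int[mu]_(t in `[0, +oo[) w t = 1.
Proof.
have h : 0%:R + 1 <= s by rewrite add0r.
have := mu_kernel_moment 0%N h.
rewrite addr0 subr0 divff ?gt_eqF// => E.
rewrite /Rintegral -[RHS]/(fine (1%:E : \bar R)) -E; congr fine.
by apply: eq_integral => t _; rewrite mulr1.
Qed.

Let s3 : 2 <= s - 1. Proof. by move: nrho; lra. Qed.

Let B1 : Beta (a + 1 + 1) (s - 1) = M1 * Beta (a + 1) s.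
Proof.
have h : 1 <= a + 1 by rewrite lerDr.
have h2 : 2 <= s by move: s3; lra.
have := Beta_rec (a + 1) s h h2; set X := Beta _ _; set Y := Beta _ _ => E.
have z : s - 1 != 0 by rewrite gt_eqF//; move: s3; lra.
by apply: (mulfI z); rewrite E /M1; field.
Qed.

Lemma mu_kernel_mean : \int[mu]_(t in `[0, +oo[) (w t * t) = M1.
Proof.
have h : 1%:R + 1 <= s by move: s3; lra.
by rewrite /Rintegral (mu_kernel_moment 1%N h) B1 mulfK ?gt_eqF.
Qed.

(** A second use of [Beta_rec], on top of the one that gave the mean. *)
Lemma mu_kernel_second_moment : \int[mu]_(t in `[0, +oo[) (w t * t ^+ 2) = M2.
Proof.
have h : 1 <= a + 1 + 1 by move: a0; lra.
have := Beta_rec (a + 1 + 1) (s - 1) h s3; rewrite B1.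
set X := Beta _ _ => E.
have z : s - 2 != 0 by rewrite gt_eqF//; move: s3; lra.
have z1 : s - 1 != 0 by rewrite gt_eqF//; move: s3; lra.
have XE : X = M2 * Beta (a + 1) s.
  apply: (mulfI z); rewrite (_ : s - 2 = s - 1 - 1); last by ring.
  rewrite E /M1 /M2; field.
  by rewrite z z1.
have s2 : 2 + 1 <= s by move: s3; lra.
have := mu_kernel_moment 2%N s2.
rewrite (_ : a + 1 + 2 = a + 1 + 1 + 1); last by ring.
rewrite (_ : s - 2 = s - 1 - 1); last by ring.
rewrite -/X XE mulfK ?gt_eqF// => E'.
by rewrite /Rintegral E'.
Qed.

(** The kernel is a probability density with mean [M1] and second moment [M2], so a quadratic
    majorant integrates explicitly. The coefficients may have any sign, which admits majorants
    expanded from [(t - x) ^ 2]. *)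
Lemma mu_kernel_quadratic_bound (g : R -> R) (c0 c1 c2 : R) :
  measurable_fun (`[0, +oo[%classic : set R) g ->
  (forall t, 0 <= t -> `|g t| <= c0 + c1 * t + c2 * t ^+ 2) ->
  mu.-integrable `[0, +oo[ (fun t => (w t * g t)%:E) /\
  `|\int[mu]_(t in `[0, +oo[) (w t * g t)| <= c0 + c1 * M1 + c2 * M2.
Proof.
move=> mg gc.
have h0 : 0%:R + 1 <= s by rewrite add0r.
have h1 : 1%:R + 1 <= s by move: s3; lra.
have h2 : 2%:R + 1 <= s by move: s3; lra.
pose D : set R := `[0, +oo[%classic.
have mD : measurable D by exact: measurable_itv.
pose h j t : R := w t * t ^+ j.
have i0 : mu.-integrable D (EFin \o h 0%N) := mu_kernel_moment_integrable 0%N h0.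
have i1 : mu.-integrable D (EFin \o h 1%N) := mu_kernel_moment_integrable 1%N h1.
have i2 : mu.-integrable D (EFin \o h 2%N) := mu_kernel_moment_integrable 2%N h2.
have Zi (c : R) (p : R -> R) : mu.-integrable D (EFin \o p) ->
    mu.-integrable D (EFin \o (fun t => c * p t)).
  by move=> ip; exact: (@integrableZl _ _ _ mu D (measurable_itv _) c _ ip).
have Di (p q : R -> R) : mu.-integrable D (EFin \o p) ->
    mu.-integrable D (EFin \o q) -> mu.-integrable D (EFin \o (fun t => p t + q t)).
  by move=> ip iq; exact: (@integrableD _ _ _ mu D (measurable_itv _) _ _ ip iq).
pose G t : R := c0 * h 0%N t + c1 * h 1%N t + c2 * h 2%N t.
have j0 := Zi c0 _ i0; have j1 := Zi c1 _ i1; have j2 := Zi c2 _ i2.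
have j01 := Di _ _ j0 j1.
have iG : mu.-integrable D (EFin \o G) := Di _ _ j01 j2.
have GE : \int[mu]_(t in D) G t = c0 + c1 * M1 + c2 * M2.
  rewrite /G (RintegralD _ j01 j2)// (RintegralD _ j0 j1)//.
  rewrite !RintegralZl// mu_kernel_mean mu_kernel_second_moment.
  rewrite [X in c0 * X](_ : _ = 1) ?mulr1// -mu_kernel_mass.
  by apply: eq_Rintegral => t _; rewrite /h mulr1.
have gG t : D t -> `|w t * g t| <= G t.
  rewrite /D/= in_itv/= andbT => t0.
  rewrite normrM ger0_norm ?mu_kernel_ge0//.
  rewrite (_ : G t = w t * (c0 + c1 * t + c2 * t ^+ 2)); last by rewrite /G /h; ring.
  by rewrite ler_wpM2l ?mu_kernel_ge0// gc.
have ig : mu.-integrable D (EFin \o (fun t => w t * g t)).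
  apply: le_integrable iG => //.
    apply/measurable_EFinP/measurable_funM => //.
    by apply: measurable_funTS; exact: measurable_mu_kernel.
  by move=> t Dt; have := le_trans (gG t Dt) (ler_norm _); rewrite -lee_fin.
split; first exact: ig.
apply: (@le_trans _ _ (\int[mu]_(t in D) `|w t * g t|)).
  exact: le_normr_Rintegral.
rewrite -GE; apply: le_Rintegral => //.
exact: integrable_norm.
Qed.

Lemma mu_kernel_error_bound (g : R -> R) (y c0 c1 c2 : R) :
  measurable_fun (`[0, +oo[%classic : set R) g ->
  (forall t, 0 <= t -> `|g t - y| <= c0 + c1 * t + c2 * t ^+ 2) ->
  `|\int[mu]_(t in `[0, +oo[) (w t * g t) - y| <= c0 + c1 * M1 + c2 * M2.
Proof.
move=> mg gy.
(* The constant is enlarged by [|y|] only to obtain integrability of [w * g], so that the integral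
   of [w * (g - y)] can be split. *)
have [|t t0|ig _] := mu_kernel_quadratic_bound g (c0 + `|y|) c1 c2; first exact: mg.
  rewrite -(subrK y (g t)) (le_trans (ler_normD _ _))//.
  by rewrite -!addrA [`|y| + _]addrC !addrA lerD2r gy.
have [||ig' le'] := mu_kernel_quadratic_bound (fun t => g t - y) c0 c1 c2.
- by apply: measurable_funB => //; exact: measurable_cst.
- exact: gy.
rewrite (_ : _ - y = \int[mu]_(t in `[0, +oo[) (w t * (g t - y))); first exact: le'.
have wi : mu.-integrable `[0, +oo[ (EFin \o w).
  have h0 : 0%:R + 1 <= s by rewrite add0r.
  apply: eq_integrable (mu_kernel_moment_integrable 0%N h0) => // t _.
  by rewrite mulr1.
transitivity (\int[mu]_(t in `[0, +oo[) (w t * g t - w t * y)).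
  rewrite RintegralB//; first by rewrite RintegralZr// mu_kernel_mass mul1r.
  exact: (@integrableZr _ _ _ mu _ (measurable_itv _) y _ wi).
by apply: eq_Rintegral => t _; rewrite mulrBr.
Qed.

End MuKernel.

(** * Modulus of continuity in the weighted space *)

Section Modulus.
Context {R : realType}.
Implicit Types (f g : R -> R) (x t : R).

(** Heine's theorem in a form where only [x] stays in the segment and [t] may leave it. Compactness
    is used as a covering property along the filter of small positive radii. *)
Lemma continuous_segment_unif g (M delta : R) : continuous g -> 0 < delta ->
  exists2 d : R, 0 < d & forall x t, 0 <= x <= M -> `|t - x| < d ->
    `|g t - g x| <= delta.
Proof.
move=> cg delta0.
pose P (d x : R) := forall t, `|t - x| < d -> `|g t - g x| <= delta.
have := @segment_compact R 0 M => /compact_near_coveringP.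
move=> /(_ R (0^'+) P _)[].
  move=> x _.
  have delta20 : 0 < delta / 2 by rewrite divr_gt0.
  have /cvgrPdist_lt/(_ _ delta20)/nbhs_ballP[r /= r0 xr] := cg x.
  have r20 : 0 < r / 2 by rewrite divr_gt0.
  exists (ball x (r / 2), [set d | d < r / 2]).
    by split; [exact: nbhsx_ballx|exact: nbhs_right_lt].
  move=> [x' d]/= [xx' dr] t tx'.
  have h1 := xr x'; have h2 := xr t.
  rewrite -(subrKA (g x)) (le_trans (ler_normD _ _))//.
  have -> : delta = delta / 2 + delta / 2 by lra.
  apply: lerD.
    rewrite distrC; apply/ltW/h2; rewrite /ball/=.
    rewrite -(subrKA x') (le_lt_trans (ler_normD _ _))//.
    rewrite (splitr r) ltrD// distrC (lt_trans tx')//.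
  apply/ltW/h1; apply: le_ball xx'; move: r0; lra.
move=> r /= r0 rP; have r20 : 0 < r / 2 by rewrite divr_gt0.
exists (r / 2) => // x t x0M tx.
apply: (rP (r / 2)) tx => //=.
by rewrite sub0r normrN gtr0_norm// ltr_pdivrMr// ltr_pMr// ltr1n.
Qed.

(** The even extension makes a function controlled only on the half-line continuous on the whole
    line. *)
Lemma continuous_comp_norm f :
  {within `[0, +oo[, continuous f} -> continuous (fun x => f `|x|).
Proof.
move=> /continuous_within_itvcyP[cf f0] x.
have [->|x0] := eqVneq x 0; last first.
  apply: (@continuous_comp _ _ _ (fun x => `|x|) f); first exact: norm_continuous.
  by apply: cf; rewrite in_itv/= andbT normr_gt0.
apply/cvgrPdist_lt => e e0.
move/cvgrPdist_lt : f0 => /(_ e e0)[r /= r0 fr].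
exists r => //= u; rewrite /ball_/= sub0r normrN => ur; rewrite normr0.
have [->|u0] := eqVneq u 0; first by rewrite normr0 subrr normr0.
by apply: fr; rewrite /= ?normr_gt0// sub0r normrN normr_id.
Qed.

(** Only [|g|] is known to converge. If [l <= 0], values far out are at most [delta / 2] in absolute
    value. If [l > 0], [g] has no zero far out, hence constant sign by the intermediate value
    theorem, and [g] inherits the oscillation of [|g|]. *)
Lemma abs_cvg_oscillation_pinfty g (l delta : R) :
  continuous g -> `|g x| @[x --> +oo] --> l -> 0 < delta ->
  exists2 M : R, 0 <= M & forall x t, M <= x -> M <= t -> `|g t - g x| <= delta.
Proof.
move=> cg gl delta0.
have bnd e : 0 < e -> exists2 M : R, 0 <= M & forall x, M <= x -> `| `|g x| - l| <= e.
  move=> e0; move/cvgrPdist_le : gl => /(_ e e0)[M [Mr HM]].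
  exists (Num.max 0 M + 1); first by rewrite addr_ge0// le_max lexx.
  move=> x xM; rewrite distrC; apply: HM; apply: lt_le_trans xM.
  by rewrite ltr_pwDr// le_max lexx orbT.
have [l0|l0] := leP l 0.
  have [M M0 HM] := bnd (delta / 2) (divr_gt0 delta0 (ltr0Sn _ 1)).
  exists M => // x t xM tM.
  have := HM _ xM; rewrite ler_norml => /andP[_ h1].
  have := HM _ tM; rewrite ler_norml => /andP[_ h2].
  apply: (le_trans (ler_normB _ _)); lra.
(* [l / 2] keeps [|g|] away from 0, and [delta / 2] bounds the oscillation by [delta]. *)
pose e := Num.min (delta / 2) (l / 2).
have e0 : 0 < e by rewrite lt_min !divr_gt0.
have e1 : e <= delta / 2 by rewrite ge_min lexx.
have e2 : e <= l / 2 by rewrite ge_min lexx orbT.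
have [M M0 HM] := bnd e e0.
have nz c : M <= c -> g c != 0.
  move=> /HM; apply: contraTneq => ->.
  by rewrite normr0 sub0r normrN gtr0_norm// -ltNge; lra.
have sgn x t : M <= x -> x <= t -> 0 < g x * g t.
  move=> xM xt; have tM := le_trans xM xt.
  rewrite ltNge; apply/negP => gxt.
  have zero_between : Num.min (g x) (g t) <= 0 <= Num.max (g x) (g t).
    have [g0|g0|g0] := ltgtP (g x) 0; last by move: (nz x xM); rewrite g0 eqxx.
      have gt0 : 0 <= g t by rewrite -(ler_nM2l g0) mulr0.
      by rewrite ge_min le_max (ltW g0) gt0 orbT.
    have gt0 : g t <= 0 by rewrite -(ler_pM2l g0) mulr0.
    by rewrite ge_min le_max (ltW g0) gt0 orbT.
  have [c] := IVT xt (continuous_subspaceT cg) zero_between.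
  rewrite in_itv/= => /andP[xc _] /eqP; apply/negP.
  by rewrite nz// (le_trans xM).
exists M => //.
suff H x t : M <= x -> x <= t -> `|g t - g x| <= delta.
  move=> x t xM tM; have [xt|/ltW tx] := leP x t; first exact: H.
  by rewrite distrC; exact: H.
move=> xM xt; have tM := le_trans xM xt.
have := HM _ xM; have := HM _ tM; rewrite !ler_norml => /andP[h1 h2] /andP[h3 h4].
have := sgn x t xM xt.
have [g0|g0|g0] := ltgtP (g x) 0; last by move: (nz x xM); rewrite g0 eqxx.
  rewrite nmulr_rgt0// => gt0; move: h1 h2 h3 h4.
  rewrite (ltr0_norm g0) (ltr0_norm gt0) => *; apply/andP; split; lra.
rewrite pmulr_rgt0// => gt0; move: h1 h2 h3 h4.
rewrite (gtr0_norm g0) (gtr0_norm gt0) => *; apply/andP; split; lra.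
Qed.

(** With [q = f / (1 + x ^ 2)], the increment splits as [(q t - q x) (1 + x ^ 2) + q t (t ^ 2 - x ^
    2)]. The first term is small when [x] and [t] are close or both far out; otherwise [1 + x ^ 2]
    is at most a multiple of [(t - x) ^ 2]. The second is handled by AM-GM. *)
Lemma C2star_modulus f (eps : R) : C2star f -> 0 < eps ->
  exists2 C : R, 0 <= C & forall x t, 0 <= x -> 0 <= t ->
    `|f t - f x| <= eps * (1 + x ^+ 2) + C * (t - x) ^+ 2.
Proof.
move=> [[[A A0 fA] cf] [l fl]] eps0.
pose q x := f `|x| / (1 + x ^+ 2).
have p1 x : 0 < 1 + x ^+ 2 by rewrite ltr_pwDl// sqr_ge0.
have cq : continuous q.
  move=> x; apply: cvgM; first exact: continuous_comp_norm.
  apply: cvgV; first by rewrite gt_eqF.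
  by apply: cvgD; [exact: cvg_cst|exact: exprn_continuous].
have qA x : `|q x| <= A.
  rewrite normrM normfV (gtr0_norm (p1 x)) ler_pdivrMr//.
  by rewrite -[x ^+ 2]real_normK ?num_real// fA.
have ql : `|q x| @[x --> +oo] --> l.
  apply: cvg_trans fl; apply: near_eq_cvg; near=> x.
  have x0 : 0 <= x by near: x; exact: nbhs_pinfty_ge.
  by rewrite normrM normfV (gtr0_norm (p1 x)) (ger0_norm x0).
pose delta := eps / 2.
have delta0 : 0 < delta by rewrite divr_gt0.
have [M M0 HM] := abs_cvg_oscillation_pinfty q l delta cq ql delta0.
(* The margin 1 beyond [M] ensures [x - t >= 1] when [x > M + 1] and [t < M]. *)
have [d0 d00 Hd] := continuous_segment_unif q (M + 1) delta cq delta0.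
pose d := Num.min d0 1.
have dp : 0 < d by rewrite lt_min d00 ltr01.
have dd0 : d <= d0 by rewrite ge_min lexx.
have d1 : d <= 1 by rewrite ge_min lexx orbT.
pose K := 1 + (M + 1) ^+ 2.
have K1 : 1 <= K by rewrite lerDl sqr_ge0.
have K0 : 0 < K := lt_le_trans ltr01 K1.
pose C1 := 2 * A * K * (1 + d ^- 2).
have V0 : 0 <= d ^- 2 by rewrite invr_ge0 sqr_ge0.
have C10 : 0 <= C1   by rewrite mulr_ge0 ?addr_ge0// mulr_ge0 ?(ltW K0)// mulr_ge0 ?(ltW A0).
have q2A x t : `|q t - q x| <= 2 * A.
  by rewrite (le_trans (ler_normB _ _))// mulr2n mulrDl mul1r lerD.
have small x t : `|q t - q x| <= delta ->
    `|q t - q x| * (1 + x ^+ 2) <= delta * (1 + x ^+ 2) + C1 * (t - x) ^+ 2.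
  move=> h; apply: (@le_trans _ _ (delta * (1 + x ^+ 2))).
    by rewrite ler_wpM2r// ltW.
  by rewrite lerDl mulr_ge0 ?sqr_ge0.
have large x t : 1 + x ^+ 2 <= K * (1 + d ^- 2) * (t - x) ^+ 2 ->
    `|q t - q x| * (1 + x ^+ 2) <= delta * (1 + x ^+ 2) + C1 * (t - x) ^+ 2.
  move=> h; apply: (@le_trans _ _ (C1 * (t - x) ^+ 2)); last first.
    by rewrite lerDr mulr_ge0// ltW.
  have -> : C1 * (t - x) ^+ 2 = 2 * A * (K * (1 + d ^- 2) * (t - x) ^+ 2).
    by rewrite /C1 !mulrA.
  by apply: ler_pM => //; exact: ltW.
have HQ x t : 0 <= x -> 0 <= t ->
    `|q t - q x| * (1 + x ^+ 2) <= delta * (1 + x ^+ 2) + C1 * (t - x) ^+ 2.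
  move=> x0 t0; have [xM|Mx] := leP x (M + 1).
    have [tx|dtx] := ltP `|t - x| d.
      by apply: small; apply: Hd; [rewrite x0|exact: lt_le_trans tx dd0].
    apply: large; apply: (@le_trans _ _ K).
      by rewrite lerD2l ler_sqr ?nnegrE// addr_ge0.
    rewrite -mulrA ler_peMr ?(ltW K0)//.
    rewrite mulrDl mul1r ler_wpDl ?sqr_ge0//.
    rewrite mulrC ler_pdivlMr ?exprn_gt0// mul1r -[leRHS]real_normK ?num_real//.
    by rewrite ler_sqr ?nnegrE// ltW.
  have xM : M <= x by rewrite (le_trans _ (ltW Mx))// lerDl.
  have [Mt|tM] := leP M t; first by apply: small; exact: HM.
  apply: large; apply: (@le_trans _ _ (K * (t - x) ^+ 2)); last first.
    by rewrite ler_wpM2r ?sqr_ge0// ler_peMr ?(ltW K0)// lerDl.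
  have y1 : 1 <= x - t by lra.
  (* From [t < M] and [x - t >= 1]: [x < M + (x - t) <= (M + 1) (x - t)]. *)
  have y2 : x <= (M + 1) * (x - t) by nra.
  have y3 : x ^+ 2 <= ((M + 1) * (x - t)) ^+ 2.
    by rewrite ler_sqr ?nnegrE// (le_trans x0).
  have y4 : 1 <= (x - t) ^+ 2 by rewrite expr_ge1// (le_trans ler01).
  by rewrite -[(t - x) ^+ 2]sqrrN opprB /K mulrDl mul1r -exprMn lerD.
(* [C1] comes from the variation of [q], [A] from the square in [h3], and [A ^ 2 / delta] from the
   AM-GM step [h4]. *)
exists (C1 + A + A ^+ 2 / delta).
  by rewrite !addr_ge0// ?(ltW A0)// divr_ge0 ?sqr_ge0// ltW.
move=> x t x0 t0.
have fq y : 0 <= y -> f y = q y * (1 + y ^+ 2).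
  by move=> y0; rewrite /q ger0_norm// divfK// gt_eqF.
rewrite (fq x)// (fq t)//.
rewrite (_ : _ - _ = (q t - q x) * (1 + x ^+ 2) + q t * (t ^+ 2 - x ^+ 2)); last by ring.
apply: (le_trans (ler_normD _ _)).
rewrite (normrM (q t - q x)) (normrM (q t)) (gtr0_norm (p1 x)).
have h1 := HQ x t x0 t0.
have h2 : `|q t| * `|t ^+ 2 - x ^+ 2| <= A * `|t ^+ 2 - x ^+ 2| by rewrite ler_wpM2r.
have h3 : `|t ^+ 2 - x ^+ 2| <= (t - x) ^+ 2 + 2 * x * `|t - x|.
  rewrite (_ : t ^+ 2 - x ^+ 2 = (t - x) ^+ 2 + 2 * x * (t - x)); last by ring.
  have x20 : 0 <= 2 * x by rewrite mulr_ge0.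
  apply: (le_trans (ler_normD _ _)).
  by rewrite (ger0_norm (sqr_ge0 _)) (normrM (2 * x)) (ger0_norm x20).
have h4 : 2 * A * x * `|t - x| <= delta * x ^+ 2 + A ^+ 2 / delta * (t - x) ^+ 2.
  rewrite -subr_ge0 -[(t - x) ^+ 2]real_normK ?num_real//.
  rewrite (_ : _ - _ = (delta * x - A * `|t - x|) ^+ 2 / delta).
    by rewrite divr_ge0 ?sqr_ge0// ltW.
  by field; rewrite gt_eqF.
have h5 := ler_wpM2l (ltW A0) h3.
have -> : eps = delta + delta by rewrite /delta -splitr.
move: h1 h2 h4 h5 delta0; clear.
set D := A ^+ 2 / delta; lra.
Unshelve. all: by end_near. Qed.

End Modulus.

(** * Convergence *)

Section Approximation.
Context {R : realType}.
Variables (rho : R) (n : nat).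
Hypotheses (rho0 : 0 < rho) (nrho : 4 <= n%:R * rho).
Local Notation s := (n%:R * rho).

Let s_gt0 : 0 < s. Proof. exact: lt_le_trans nrho. Qed.

Let denominator_ge : s ^+ 2 / 4 <= (s - 1) * (s - 2).
Proof. by move: nrho; set z := s; nra. Qed.

Let denominator_gt0 : 0 < (s - 1) * (s - 2).
Proof. by apply: lt_le_trans denominator_ge; rewrite divr_gt0// exprn_gt0. Qed.

(** Bounds the second moment of the kernel through [(s - 1) (s - 2) >= s ^ 2 / 4], valid for
    [s >= 4]. It is applied with [y = k / (n - 1)], the node at which the deviation lemma measures
    growth. *)
Lemma second_moment_growth k (y : R) : k%:R * rho <= y * s ->
  (k%:R * rho + 1) * (k%:R * rho + 2) / ((s - 1) * (s - 2)) <= 2 + 8 * y ^+ 2.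
Proof.
move=> ays; have a0 : 0 <= k%:R * rho by rewrite mulr_ge0// ltW.
move: ays a0; set a := k%:R * rho => ays a0.
rewrite ler_pdivrMr//.
apply: (@le_trans _ _ ((2 + 8 * y ^+ 2) * (s ^+ 2 / 4))); last first.
  by rewrite ler_wpM2l// addr_ge0// mulr_ge0// sqr_ge0.
have h1 : a ^+ 2 <= (y * s) ^+ 2 by rewrite ler_sqr ?nnegrE// (le_trans a0).
have h2 : 16 <= s ^+ 2.
  by rewrite (_ : 16 = 4 ^+ 2); [rewrite ler_sqr ?nnegrE// ltW|ring].
rewrite [(y * s) ^+ 2]exprMn in h1.
have h3 := sqr_ge0 (a - 2).
have h4 := sqr_ge0 a.
rewrite (_ : (2 + 8 * y ^+ 2) * (s ^+ 2 / 4) = s ^+ 2 / 2 + 2 * (y ^+ 2 * s ^+ 2)); last by field.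
move: h1 h2 h3 h4; set S := s ^+ 2; set T := y ^+ 2 * S; lra.
Qed.

(** The left side is the image of [(t - x) ^ 2] under the positive part of the operator: the kernel
    moments averaged by the negative binomial weights of parameter [n]. *)
Lemma mean_error_growth (x : R) : 0 <= x ->
  (s * (rho * (x * (1 + x)) + x + x ^+ 2) + 2 + 4 * x + 2 * x ^+ 2)
    / ((s - 1) * (s - 2)) <= (1 + x ^+ 2) * ((8 * rho + 12) / s).
Proof.
move=> x0; rewrite ler_pdivrMr//.
apply: (@le_trans _ _ ((1 + x ^+ 2) * ((8 * rho + 12) / s) * (s ^+ 2 / 4))); last first.
  rewrite ler_wpM2l// mulr_ge0 ?addr_ge0 ?sqr_ge0// divr_ge0 ?(ltW s_gt0)//.
  by rewrite addr_ge0// mulr_ge0// ltW.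
rewrite (_ : _ * (s ^+ 2 / 4) = s * (2 * rho * (1 + x ^+ 2)) + s * (3 * (1 + x ^+ 2))); last first.
  have nz : n%:R != 0 :> R by apply: contraTneq s_gt0 => ->; rewrite mul0r ltxx.
  by field; rewrite nz gt_eqF.
have h1 : rho * (x * (1 + x)) <= rho * (2 * (1 + x ^+ 2)).
  by rewrite ler_pM2l//; have := sqr_ge0 (x - 1); nra.
have h2 : s * (rho * (x * (1 + x))) <= s * (rho * (2 * (1 + x ^+ 2))).
  by rewrite ler_pM2l.
have h3 : 0 <= (s - 4) * (1 + x ^+ 2).
  by rewrite mulr_ge0 ?subr_ge0// addr_ge0// sqr_ge0.
have h4 : 0 <= s * (1 - x) ^+ 2 by rewrite mulr_ge0 ?sqr_ge0// ltW.
have h5 := sqr_ge0 (x - 1).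
have h6 : 0 <= s * x ^+ 2 by rewrite mulr_ge0 ?sqr_ge0// ltW.
move: h2 h3 h4 h5 h6 s_gt0; set S := s; lra.
Qed.

End Approximation.

(** * Pointwise error of the operator *)

Section PointwiseError.
Context {R : realType}.
Variables (alpha rho : R) (p : nat).
Hypotheses (halpha : 0 <= alpha <= 1) (rho0 : 0 < rho) (nrho : 4 <= p.+2%:R * rho).
Local Notation s := (p.+2%:R * rho).

(** Instance of [bask_sum_error] with [J k] the kernel integral of [f] and [y = f x]. The growth
    constant is [K = 8 * A], whence [4 * K = 32 * A]. *)
Lemma bask_op_error (f : R -> R) (A eps C eta x : R) :
  {within `[0, +oo[, continuous f} ->
  (forall t, 0 <= t -> `|f t| <= A * (1 + t ^+ 2)) ->
  (forall t, 0 <= t -> `|f t - f x| <= eps * (1 + x ^+ 2) + C * (t - x) ^+ 2) ->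
  0 <= C -> 0 < eta -> 0 <= x ->
  `|bask_op alpha rho p.+2 f x - f x| <=
  (1 + x ^+ 2) * (eps + C * ((8 * rho + 12) / s)
                  + 32 * A * (2 * eta + 11 / (p.+1%:R * eta))).
Proof.
move=> cf fA fx C0 eta0 x0.
have mf : measurable_fun (`[0, +oo[%classic : set R) f.
  by apply: subspace_continuous_measurable_fun.
have A0 : 0 <= A.
  by have := le_trans (normr_ge0 _) (fA 0 (lexx _)); rewrite expr0n/= addr0 mulr1.
have m0 : 0 < p.+1%:R :> R by rewrite ltr0n.
(* The kernel integral of [eps (1 + x ^ 2) + C (t - x) ^ 2], expanded in powers of [t]; [S] is its
   average over [k]. *)
pose V k := eps * (1 + x ^+ 2) + C * x ^+ 2
  + (- 2 * C * x) * ((k%:R * rho + 1) / (s - 1))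
  + C * ((k%:R * rho + 1) * (k%:R * rho + 2) / ((s - 1) * (s - 2))).
pose S := eps * (1 + x ^+ 2)
  + C * ((s * (rho * (x * (1 + x)) + x + x ^+ 2) + 2 + 4 * x + 2 * x ^+ 2)
         / ((s - 1) * (s - 2))).
apply: (@le_trans _ _ (S + 4 * (8 * A) *
   ((1 + x ^+ 2) * (2 * eta + 11 / (p.+1%:R * eta))))).
  apply: (bask_sum_error alpha p x eta _ V) => //.
  - move=> k; have [||_ le] := mu_kernel_quadratic_bound rho p.+2 k rho0 nrho f A 0 A.
    + exact: mf.
    + by move=> t t0; rewrite mul0r addr0 (le_trans (fA t t0))// mulrDr mulr1.
    apply: le_trans le _; rewrite mul0r addr0.
    have h : k%:R * rho <= k%:R / p.+1%:R * s.
      rewrite mulrA ler_pM2r// mulrAC ler_pdivlMr//.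
      by rewrite ler_wpM2l// ler_nat.
    have := ler_wpM2l A0 (second_moment_growth rho p.+2 rho0 nrho k _ h).
    have := mulr_ge0 A0 (sqr_ge0 (k%:R / p.+1%:R)).
    set Y := _ ^+ 2; set M := _ / _; lra.
  - move=> k; apply: mu_kernel_error_bound => // t t0.
    apply: (le_trans (fx t t0)); rewrite le_eqVlt; apply/orP; left.
    by apply/eqP; ring.
  - pose D := (s - 1) * (s - 2).
    have D0 : D != 0.
      by rewrite gt_eqF// mulr_gt0//; move: nrho; set z := s; lra.
    have s10 : s - 1 != 0 by move: D0; rewrite mulf_eq0 negb_or => /andP[].
    have s20 : s - 2 != 0 by move: D0; rewrite mulf_eq0 negb_or => /andP[].
    (* [V k] rewritten as a polynomial in [k]; its cubic and quartic coefficients are 0. *)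
    have := nbin_moments p.+1 x
      (eps * (1 + x ^+ 2) + C * x ^+ 2 + (- 2 * C * x) / (s - 1) + C * 2 / D)
      ((- 2 * C * x) * rho / (s - 1) + C * (3 * rho) / D)
      (C * rho ^+ 2 / D) 0 0 x0.
    set T := (X in _ --> X -> _).
    rewrite (_ : (fun k => _) = (fun k => nbin p.+1 k x * V k)); last first.
      apply/funext => k; congr *%R; rewrite /V /D.
      move: (p.+2%:R : R) s10 s20 => N s10 s20; field.
      by rewrite s10 s20.
    rewrite (_ : T = S)//.
    rewrite /T /S /D.
    move: (p.+2%:R : R) s10 s20 => N s10 s20; field.
    by rewrite s10 s20.
have h1 := ler_wpM2l C0 (mean_error_growth rho p.+2 rho0 nrho x x0).
rewrite [leRHS]mulrDr; apply: lerD.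
  rewrite (_ : _ * _ = eps * (1 + x ^+ 2) + C * ((1 + x ^+ 2) * ((8 * rho + 12) / s))).
    by rewrite lerD2l.
  by ring.
by rewrite le_eqVlt; apply/orP; left; apply/eqP; ring.
Qed.

End PointwiseError.

(** The norm takes extended real values, so it is first shown to be eventually finite, by the bound
    with [e = 1]; convergence is then that of real numbers. *)
Lemma norm2_cvg0 {R : realType} (g : nat -> R -> R) :
  (forall e : R, 0 < e -> \forall n \near \oo, forall x, 0 <= x ->
    `|g n x| <= e * (1 + x ^+ 2)) ->
  norm2 (g n) @[n --> \oo] --> 0%E.
Proof.
move=> small.
have ge0 n : (0 <= norm2 (g n))%E.
  apply: (@le_trans _ _ (`|g n 0| / (1 + 0 ^+ 2))%:E).
    by rewrite lee_fin divr_ge0// addr_ge0// sqr_ge0.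
  by apply: ereal_sup_ubound; exists 0 => //=; rewrite in_itv/= lexx.
have le e : 0 < e -> \forall n \near \oo, (norm2 (g n) <= e%:E)%E.
  move=> /small; apply: filterS => n gn.
  apply: ge_ereal_sup => _ [x xD <-].
  have x0 : 0 <= x by move: (xD : x \in `[0, +oo[); rewrite in_itv/= andbT.
  by rewrite lee_fin ler_pdivrMr ?gn// ltr_pwDl// sqr_ge0.
have fin e n : (norm2 (g n) <= e%:E)%E -> norm2 (g n) \is a fin_num.
  by move=> gne; rewrite ge0_fin_numE// (le_lt_trans gne)// ltry.
apply/fine_cvgP; split.
  by have := le 1 ltr01; apply: filterS => n; exact: fin.
apply/cvgrPdist_le => e /le; apply: filterS => n gne.
rewrite sub0r normrN ger0_norm ?fine_ge0//.
by rewrite -lee_fin fineK//; exact: fin gne.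
Qed.

Theorem theorem3 (R : realType) (alpha rho : R)
    (halpha : 0 <= alpha <= 1) (hrho : 0 < rho)
    (f : R -> R) (hf : C2star f) :
  norm2 (fun x => bask_op alpha rho n f x - f x)
    @[n --> within [set n : nat | (0 < n)%N /\ 2 < n%:R * rho] \oo] --> 0%E.
Proof.
have [[[A A0 fA] cf] _] := hf.
(* Convergence along all integers implies convergence along the restricted ones. *)
apply: cvg_trans; first by apply: cvg_app; exact: cvg_within.
apply: norm2_cvg0 => e e0.
have e40 : 0 < e / 4 by rewrite divr_gt0.
have [C C0 fC] := C2star_modulus f (e / 4) hf e40.
have B0 : 0 < 32 * A by rewrite mulr_gt0// ltr0n.
move: B0; set B := 32 * A => B0.
(* Chosen so that [B * (2 * eta) = e / 4]. The other three quarters of [e] come from the modulus of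
   [f], the [C] term, and the term in [11 / (n.-1 * eta)], the last two for large [n]. *)
pose eta := e / 8 / B.
have eta0 : 0 < eta by rewrite !divr_gt0// ltr0n.
near=> n => x x0.
have n2 : (2 <= n)%N by near: n; exact: nbhs_infty_ge.
have n4 : 4 <= n%:R * rho.
  by rewrite -ler_pdivrMr//; near: n; exact: nbhs_infty_ger.
have nC : C * ((8 * rho + 12) / (n%:R * rho)) <= e / 4.
  have : C * (8 * rho + 12) / rho / (e / 4) <= n%:R.
    by near: n; exact: nbhs_infty_ger.
  rewrite ler_pdivrMr// ler_pdivrMr// => h.
  rewrite mulrA ler_pdivrMr; last exact: lt_le_trans n4.
  by rewrite [leRHS]mulrCA mulrA.
have nA : B * (11 / (n.-1%:R * eta)) <= e / 4.
  have n1 : 0 < n.-1%:R :> R by rewrite ltr0n -ltnS prednK// (ltn_trans _ n2).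
  have : B * 11 / eta / (e / 4) + 1 <= n%:R.
    by near: n; exact: nbhs_infty_ger.
  have -> : n%:R = n.-1%:R + 1 :> R by rewrite natr1 prednK// ltnW.
  rewrite lerD2r.
  rewrite ler_pdivrMr// ler_pdivrMr// => h.
  rewrite mulrA ler_pdivrMr ?(mulr_gt0 n1 eta0)//.
  by rewrite [leRHS]mulrCA mulrA.
have [p pE] : exists p, n = p.+2 by case: (n) n2 => [|[|q]]// _; exists q.
move: n4 nC nA; rewrite pE => n4 nC nA.
apply: le_trans (bask_op_error alpha rho p halpha hrho n4 f A (e / 4) C eta x
  cf fA (fun t => fC x t x0) C0 eta0 x0) _.
rewrite [leRHS]mulrC ler_wpM2l ?addr_ge0 ?sqr_ge0// -/B.
have nE : B * (2 * eta) = e / 4 by rewrite /eta; field; rewrite gt_eqF.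
apply: (@le_trans _ _ (e / 4 + e / 4 + (e / 4 + e / 4))); last by lra.
by apply: lerD; [rewrite lerD2l|rewrite (mulrDr B) nE lerD2l].
Unshelve. all: by end_near. Qed.
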